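(* There exist a countable discrete group $\Gamma$ and a Uniformly Recurrent State $\mathcal{H}\subset\mathcal{X}_\Gamma$ such that no element of $\mathcal{H}$ is of the form $\phi_{L(H)}$ for any subgroup $H\le\Gamma$. Consequently, there are Uniformly Recurrent States that do not arise from Uniformly Recurrent Subgroups, i.e. that are not of the form $\{\phi_{L(H)}: H\in\mathcal{X}\}$ for any Uniformly Recurrent Subgroup $\mathcal{X}$ of $\Gamma$.
   Context: $L(\Gamma)$ is the group von Neumann algebra of $\Gamma$, generated by the left regular representation $\lambda$, $g\mapsto\lambda_g$, with canonical trace $\tau_0$. For a von Neumann subalgebra $\mathcal{M}\le L(\Gamma)$ (same unit), $E_{\mathcal{M}}:L(\Gamma)\to\mathcal{M}$ is the $\tau_0$-preserving conditional expectation, and $\phi_{\mathcal{M}}(g):=\tau_0(E_{\mathcal{M}}(\lambda_g)\lambda_g^* )=\|E_{\mathcal{M}}(\lambda_g)\|_2^2$ for $g\in\Gamma$. For a subgroup $H$, $L(H)\le L(\Gamma)$ is the von Neumann subalgebra generated by $\{\lambda_h:h\in H\}$. $\mathrm{PD}_1(\Gamma)$ is the space of positive definite functions $\phi$ on $\Gamma$ with $\phi(e)=1$, with the topology of pointwise convergence, on which $\Gamma$ acts by $(s\cdot\phi)(g)=\phi(s^{-1}gs)$. The compact $\Gamma$-space of subalgebra states is the pointwise closure $$\mathcal{X}_\Gamma:=\overline{\{\phi_{\mathcal{M}}:\mathcal{M}\le L(\Gamma)\}}\subset \mathrm{PD}_1(\Gamma).$$ A Uniformly Recurrent State is a non-empty,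 closed, minimal $\Gamma$-invariant subset of $\mathcal{X}_\Gamma$. A Uniformly Recurrent Subgroup (URS) of $\Gamma$ is a non-empty, closed, minimal $\Gamma$-invariant subset of $\mathrm{Sub}(\Gamma)$, the space of subgroups with the Chabauty topology and conjugation action. *)

(* Defs.v *)
From HB Require Import structures.
From mathcomp Require Import all_boot all_order all_algebra.
From mathcomp Require Import complex.
From mathcomp Require Import all_classical all_reals all_analysis.
From mathcomp Require Import ring.
From mathcomp.analysis Require showcase.summability.

Set Implicit Arguments.
Unset Strict Implicit.
Unset Printing Implicit Defensive.

Import Order.TTheory GRing.Theory Num.Theory.
Import numFieldNormedType.Exports.

Local Open Scope classical_set_scope.
Local Open Scope complex_scope.
Local Open Scope ring_scope.

Section Ell2.
Context {R : realType} {Gamma : groupType}.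
Implicit Types (f : Gamma -> R[i]) (g h : Gamma).

Definition sqnorm f : \bar R :=
  \esum_(g in [set: Gamma]) ((Normc.normc (f g)) ^+ 2)%:E.

Definition square_summable f : Prop := (sqnorm f < +oo)%E.

Definition ell2_pred : {pred Gamma -> R[i]} := fun f => `[< square_summable f >].

Let term_ge0 f (S : set Gamma) g :
  S g -> (0 <= ((Normc.normc (f g)) ^+ 2)%:E)%E.
Proof. by move=> _; rewrite lee_fin sqr_ge0. Qed.

Lemma sqnormZ_le (a : R[i]) f :
  (sqnorm (a *: f) <= ((Normc.normc a) ^+ 2)%:E * sqnorm f)%E.
Proof.
apply: ge_ereal_sup => _ [A [finA _] <-].
have -> : (\sum_(x \in A) ((Normc.normc ((a *: f) x)) ^+ 2)%:E =
    ((Normc.normc a) ^+ 2)%:E * \sum_(x \in A) ((Normc.normc (f x)) ^+ 2)%:E)%E.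
  rewrite ge0_mule_fsumr; last by move=> x; rewrite lee_fin sqr_ge0.
  by apply: eq_fsbigr => x _; rewrite -EFinM -exprMn -Normc.normcM.
apply: lee_wpmul2l; first by rewrite lee_fin sqr_ge0.
by apply: ereal_sup_ubound; exists A.
Qed.

Lemma sqnormD_le f1 f2 :
  (sqnorm (f1 + f2)%R <= (sqnorm f1 + sqnorm f2) + (sqnorm f1 + sqnorm f2))%E.
Proof.
rewrite /sqnorm -esumD; [|exact: term_ge0..].
rewrite -esumD; [|by move=> g Sg; rewrite adde_ge0 ?(term_ge0 _ Sg)..].
apply: le_esum => g _; rewrite -!EFinD lee_fin.
have le0 (z : R[i]) : 0 <= Normc.normc z by case: z => x y; exact: sqrtr_ge0.
have := le_normcD (f1 g) (f2 g).
rewrite [(f1 + f2) g]/(f1 g + f2 g).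
move: (le0 (f1 g)) (le0 (f2 g)) (le0 (f1 g + f2 g)).
move: (Normc.normc (f1 g)) (Normc.normc (f2 g)) (Normc.normc (f1 g + f2 g)) => x y z x0 y0 z0 zxy.
apply: (@le_trans _ _ ((x + y) ^+ 2)); first by rewrite ler_sqr ?nnegrE ?addr_ge0.
rewrite -subr_ge0 (_ : _ - _ = (x - y) ^+ 2) ?sqr_ge0//; last by ring.
Qed.

Lemma ell2_submod : submod_closed ell2_pred.
Proof.
split=> [|a f1 f2 /asboolP f1fin /asboolP f2fin]; apply/asboolP.
  rewrite /square_summable /sqnorm esum1 ?ltry// => g _.
  by rewrite [(0 : _ -> _) g]/(0 : R[i]) Normc.normc0 expr0n.
have afin : (sqnorm (a *: f1) < +oo)%E.
  apply: le_lt_trans (sqnormZ_le a f1) _.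
  by rewrite lte_mul_pinfty ?lee_fin ?sqr_ge0.
apply: le_lt_trans (sqnormD_le _ _) _.
by rewrite !lte_add_pinfty.
Qed.

HB.instance Definition _ := GRing.isSubmodClosed.Build _ _ ell2_pred ell2_submod.

Lemma square_summable_delta g :
  (fun h => (h == g)%:R : R[i]) \in ell2_pred.
Proof.
apply/asboolP; rewrite /square_summable.
suff -> : sqnorm (fun h => (h == g)%:R) = 1%:E by rewrite ltry.
rewrite /sqnorm (eq_esum (b := fun h => if h \in [set g] then 1%:E else 0%E)).
  by rewrite -esum_mkcond esum_set1 ?lee_fin.
move=> h _; case: eqVneq => [->|hg].
  by rewrite mem_set// -[true%:R]/1 Normc.normc1 expr1n.
by rewrite -[false%:R]/0 Normc.normc0 expr0n memNset//= => /eqP; rewrite (negbTE hg).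
Qed.

Lemma square_summable_translate g f :
  f \in ell2_pred -> (fun h => f (g^-1 * h)%g) \in ell2_pred.
Proof.
move=> /asboolP fin; apply/asboolP.
suff -> : square_summable (fun h => f (g^-1 * h)%g) = square_summable f by [].
rewrite /square_summable /sqnorm; congr (_ < _)%E; apply/esym.
apply: (@reindex_esum _ _ _ _ _ (fun h => (g^-1 * h)%g)); split => //.
- by move=> x y _ _ /mulgI.
- by move=> x _; exists (g * x)%g => //; rewrite mulKg.
Qed.

End Ell2.

(* The Hilbert space l^2(Gamma) *)
Record ell2 (R : realType) (Gamma : groupType) := Ell2 {
  ell2_fun :> Gamma -> R[i] ;
  _ : ell2_fun \in ell2_pred }.

HB.instance Definition _ (R : realType) (Gamma : groupType) :=
  [isSub for @ell2_fun R Gamma].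
HB.instance Definition _ (R : realType) (Gamma : groupType) :=
  [Choice of ell2 R Gamma by <:].
HB.instance Definition _ (R : realType) (Gamma : groupType) :=
  [SubChoice_isSubLmodule of ell2 R Gamma by <:].

Section Operators.
Context {R : realType} {Gamma : groupType}.
Local Notation l2 := (ell2 R Gamma).
Implicit Types (xi eta : l2) (S T : l2 -> l2) (g h : Gamma).

(* Unordered sum over Gamma: the limit of the finite partial sums along the
   net of finite subsets of Gamma. *)
Definition ell2_inner xi eta : R[i] :=
  @summability.sum Gamma R[i] R[i]^o (fun g => xi g * (eta g)^*).

Definition ell2_norm xi : R := Num.sqrt (fine (sqnorm xi)).

Definition ell2_delta g : l2 := Ell2 (square_summable_delta g).

Definition bounded_op : set (l2 -> l2) := [set T | linear T /\
  exists K : R, forall xi, ell2_norm (T xi) <= K * ell2_norm xi].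

Definition is_adjoint T S : Prop :=
  forall xi eta, ell2_inner (T xi) eta = ell2_inner xi (S eta).

(* By the Riesz theorem every bounded operator has exactly one bounded adjoint,
   so the default value of [xget] is irrelevant on [bounded_op]. *)
Definition op_adj T : l2 -> l2 :=
  xget (fun=> 0) [set S | bounded_op S /\ is_adjoint T S].

Definition positive_op T : Prop := forall xi, 0 <= ell2_inner (T xi) xi.

Definition commutant (A : set (l2 -> l2)) : set (l2 -> l2) :=
  [set T | bounded_op T /\ forall S, A S -> T \o S = S \o T].

(* Unital *-subalgebras of B(l^2(Gamma)) equal to their bicommutant *)
Definition vN_algebra (A : set (l2 -> l2)) : Prop :=
  [/\ A `<=` bounded_op /\ A id,
      (forall (a : R[i]) S T, A S -> A T -> A (fun xi => a *: S xi + T xi)),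
      (forall S T, A S -> A T -> A (S \o T)),
      (forall T, A T -> A (op_adj T)) &
      commutant (commutant A) = A].

(* The left regular representation: lambda_g delta_h = delta_{gh} *)
Definition lreg g : l2 -> l2 :=
  fun xi => Ell2 (square_summable_translate g (valP xi)).

(* L(H), as a von Neumann subalgebra of B(l^2(Gamma)) *)
Definition gvN (H : {pred Gamma}) : set (l2 -> l2) :=
  smallest vN_algebra [set lreg h | h in [set h | h \in H]].

Definition gvNT : set (l2 -> l2) := gvN predT.

Definition tau0 T : R[i] := ell2_inner (T (ell2_delta 1%g)) (ell2_delta 1%g).

Definition vN_subalgebra (M : set (l2 -> l2)) : Prop :=
  vN_algebra M /\ M `<=` gvNT.

(* [E] is the tau0-preserving conditional expectation L(Gamma) -> M; its values
   outside [gvNT] are unconstrained. *)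
Definition is_cond_exp (M : set (l2 -> l2))
    (E : (l2 -> l2) -> (l2 -> l2)) : Prop :=
  [/\ (forall x, gvNT x -> M (E x)) /\ (forall m, M m -> E m = m),
      (forall (a : R[i]) x y, gvNT x -> gvNT y ->
         E (fun xi => a *: x xi + y xi) = (fun xi => a *: E x xi + E y xi)),
      (forall m n x, M m -> M n -> gvNT x ->
         E (m \o x \o n) = m \o E x \o n),
      (forall x, gvNT x -> positive_op x -> positive_op (E x)) &
      (forall x, gvNT x -> tau0 (E x) = tau0 x)].

(* For a von Neumann subalgebra [M] of L(Gamma) the trace-preserving
   conditional expectation exists and is unique on L(Gamma). *)
Definition cond_exp (M : set (l2 -> l2)) : (l2 -> l2) -> (l2 -> l2) :=
  xget (fun x : l2 -> l2 => x) [set E | is_cond_exp M E].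

(* phi_M(g) = tau0(E_M(lambda_g) lambda_g^* ) *)
Definition phi_state (M : set (l2 -> l2)) : Gamma -> R[i] :=
  fun g => tau0 (cond_exp M (lreg g) \o op_adj (lreg g)).

Definition positive_definite (f : Gamma -> R[i]) : Prop :=
  forall (n : nat) (g : 'I_n -> Gamma) (c : 'I_n -> R[i]),
    0 <= \sum_(i < n) \sum_(j < n) c i * (c j)^* * f ((g j)^-1 * g i)%g.

Definition PD1 : set (Gamma -> R[i]) :=
  [set f | positive_definite f /\ f 1%g = 1].

Definition state_act (s : Gamma) (f : {ptws Gamma -> R[i]^o}) :
    {ptws Gamma -> R[i]^o} :=
  fun g => f (s^-1 * g * s)%g.

Definition subalgebra_states : set {ptws Gamma -> R[i]^o} :=
  PD1 `&` closure ([set phi_state M | M in vN_subalgebra] : set {ptws Gamma -> R[i]^o}).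

End Operators.

Section Dynamics.
Context {Gamma : groupType} {X : topologicalType} (act : Gamma -> X -> X).

(* Non-empty invariant subsets of the space [D], closed in [D] *)
Definition closed_invariant (D Y : set X) : Prop :=
  [/\ Y !=set0, Y `<=` D, closed (Y : set (subspace D)) &
      forall s y, Y y -> Y (act s y)].

Definition minimal_closed_invariant (D Y : set X) : Prop :=
  closed_invariant D Y /\
  forall Z, closed_invariant D Z -> Z `<=` Y -> Z = Y.

End Dynamics.

(* A subgroup is encoded by its indicator function; the Chabauty topology of
   the discrete group Gamma is the one induced from the product {0,1}^Gamma. *)
Definition subgroup_space (Gamma : groupType) : set {ptws Gamma -> bool} :=
  [set H : {ptws Gamma -> bool} | group_closed (H : {pred Gamma})].

(* s H s^-1 *)
Definition sub_act (Gamma : groupType) (s : Gamma) (H : {ptws Gamma -> bool}) :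
    {ptws Gamma -> bool} :=
  fun g => H (s^-1 * g * s)%g.

Definition uniformly_recurrent_state (R : realType) (Gamma : groupType)
    (Y : set {ptws Gamma -> R[i]^o}) : Prop :=
  minimal_closed_invariant (@state_act R Gamma) subalgebra_states Y.

Definition uniformly_recurrent_subgroup (Gamma : groupType)
    (X : set {ptws Gamma -> bool}) : Prop :=
  minimal_closed_invariant (@sub_act Gamma) (@subgroup_space Gamma) X.

(* Main.v *)
Require Import Defs.
From HB Require Import structures.
From mathcomp Require Import all_boot all_order all_algebra all_fingroup.
From mathcomp Require Import complex finmap.
From mathcomp Require Import all_classical all_reals all_analysis.
From mathcomp.analysis Require showcase.summability.

Set Implicit Arguments.
Unset Strict Implicit.
Unset Printing Implicit Defensive.

Import Order.TTheory GRing.Theory Num.Theory.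
Import numFieldNormedType.Exports.
Local Open Scope classical_set_scope.
Local Open Scope ring_scope.

(** In a finite abelian group conjugation is trivial, so every singleton
    [{phi_M}] is a Uniformly Recurrent State. Let [W] be the unitary
    [(W xi)(g) = xi(g^-1)] and [M] the fixed-point algebra of [x |-> W x W] in
    [L(Gamma)]. Then [E_M(x) = (x + W x W) / 2], so [phi_M(g) = 1/2] as soon as
    [g^2 <> 1], whereas [phi_{L(H)}] is the indicator function of [H]. The
    cyclic group of order 3 suffices. *)

(** * Bounded operators and translations on l^2 of an arbitrary group *)

Section BoundedOperators.
Context {R : realType} {Gamma : groupType}.
Local Notation l2 := (ell2 R Gamma).
Implicit Types (xi eta : l2) (S T : l2 -> l2) (A : set (l2 -> l2)).

Lemma ell2P xi eta : (forall g, xi g = eta g) -> xi = eta.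
Proof. by move=> e; apply/val_inj/funext. Qed.

Lemma sqnorm_ge0 xi : (0 <= sqnorm xi)%E.
Proof. by apply: esum_ge0 => g _; rewrite lee_fin sqr_ge0. Qed.

Lemma sqnorm_fin xi : (sqnorm xi) \is a fin_num.
Proof. rewrite ge0_fin_numE ?sqnorm_ge0//; exact/asboolP/(valP xi). Qed.

(** Squaring the norm bound removes the square root, and the new constant [K ^+ 2] is automatically
    nonnegative. Later bounds are then inequalities between unordered sums. *)
Lemma bounded_opP T : bounded_op T <->
  linear T /\ exists2 K : R, 0 <= K &
    forall xi, (sqnorm (T xi) <= K%:E * sqnorm xi)%E.
Proof.
have n2 xi : ell2_norm xi ^+ 2 = fine (sqnorm xi).
  by rewrite sqr_sqrtr// fine_ge0// sqnorm_ge0.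
have n0 xi : 0 <= ell2_norm xi by exact: sqrtr_ge0.
split=> -[linT].
  move=> [K TK]; split=> //; exists (K ^+ 2); first exact: sqr_ge0.
  move=> xi; rewrite -(fineK (sqnorm_fin (T xi))) -(fineK (sqnorm_fin xi)).
  rewrite -EFinM lee_fin -!n2 -exprMn ler_sqr ?nnegrE//.
  exact: le_trans (TK xi).
move=> [K K0 TK]; split=> //; exists (Num.sqrt K) => xi.
rewrite -sqrtrM// ler_wsqrtr// -lee_fin EFinM !fineK//; exact: sqnorm_fin.
Qed.

Lemma linear_at0 T : linear T -> T 0 = 0.
Proof.
by move=> linT; have := linT (-1) 0 0; rewrite scaler0 addr0 scaleN1r addNr.
Qed.

Lemma linear_lin2 (a b : R[i]) T xi eta : linear T ->
  T (a *: xi + b *: eta) = a *: T xi + b *: T eta.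
Proof.
move=> linT; rewrite linT; congr (_ + _).
by have := linT b eta 0; rewrite (linear_at0 linT) !addr0.
Qed.

Lemma bounded_id : bounded_op (id : l2 -> l2).
Proof. by split=> //; exists 1 => xi; rewrite mul1r. Qed.

Lemma bounded_comp S T : bounded_op S -> bounded_op T -> bounded_op (S \o T).
Proof.
move=> /bounded_opP[linS [K K0 SK]] /bounded_opP[linT [L L0 TL]].
apply/bounded_opP; split=> [a x y|] /=; first by rewrite linT linS.
exists (K * L) => [|xi]; first exact: mulr_ge0.
rewrite (le_trans (SK _))// EFinM -muleA lee_wpmul2l//.
Qed.

Lemma bounded_lin (a : R[i]) S T : bounded_op S -> bounded_op T ->
  bounded_op (fun xi => a *: S xi + T xi).
Proof.
move=> /bounded_opP[linS [K K0 SK]] /bounded_opP[linT [L L0 TL]].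
apply/bounded_opP; split=> [b x y|] /=.
  by rewrite linT linS !scalerDr addrACA !scalerA (mulrC a).
(* The final constant is [C + C] because [sqnormD_le] is the estimate |x + y|^2 <= 2 (|x|^2 +
   |y|^2). *)
pose C := Normc.normc a ^+ 2 * K + L.
have C0 : 0 <= C by rewrite addr_ge0// mulr_ge0// sqr_ge0.
exists (C + C) => [|xi]; first exact: addr_ge0.
have le1 : (sqnorm (a *: S xi) + sqnorm (T xi) <= C%:E * sqnorm xi)%E.
  have a0 : 0 <= Normc.normc a ^+ 2 by exact: sqr_ge0.
  have aK0 : 0 <= Normc.normc a ^+ 2 * K by exact: mulr_ge0.
  rewrite /C EFinD ge0_muleDl ?lee_fin// leeD//.
  rewrite (le_trans (sqnormZ_le a (S xi)))//.
  rewrite [X in (_ <= X * _)%E]EFinM -[leRHS]muleA.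
  by apply: lee_wpmul2l; [rewrite lee_fin|exact: SK].
rewrite EFinD ge0_muleDl ?lee_fin//.
apply: le_trans (leeD le1 le1).
exact: (sqnormD_le (a *: S xi : l2) (T xi)).
Qed.

Lemma isometry_bounded T :
  linear T -> (forall xi, sqnorm (T xi) = sqnorm xi) -> bounded_op T.
Proof.
by move=> linT isoT; apply/bounded_opP; split=> //; exists 1 => // xi;
  rewrite isoT mul1e.
Qed.

Lemma lreg_bounded (g : Gamma) : bounded_op (lreg g : l2 -> l2).
Proof.
apply: isometry_bounded => [a x y|xi]; first exact: ell2P.
apply/esym; rewrite /sqnorm.
apply: (@reindex_esum _ _ _ _ _ (fun h => (g^-1 * h)%g)); split => //.
- by move=> x y _ _ /mulgI.
- by move=> x _; exists (g * x)%g => //; rewrite mulKg.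
Qed.

Lemma lregM (g h : Gamma) : (lreg g : l2 -> l2) \o lreg h = lreg (g * h)%g.
Proof.
by apply/funext => xi; apply: ell2P => k /=; rewrite invgM mulgA.
Qed.

Lemma lreg1 : (lreg 1%g : l2 -> l2) = id.
Proof. by apply/funext => xi; apply: ell2P => k /=; rewrite invg1 mul1g. Qed.

Lemma lreg_delta (g h : Gamma) :
  lreg g (ell2_delta h) = ell2_delta (g * h)%g :> l2.
Proof.
apply: ell2P => k /=; congr (_ %:R); congr nat_of_bool.
by apply/eqP/eqP => [<-|->]; rewrite ?mulKVg ?mulKg.
Qed.

Lemma commutant_anti A B : A `<=` B -> commutant B `<=` commutant A.
Proof. by move=> AB T [bT cT]; split=> // S /AB; exact: cT. Qed.

Lemma sub_bicommutant A : A `<=` bounded_op -> A `<=` commutant (commutant A).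
Proof. by move=> bA T AT; split; [exact: bA|move=> S [_ /(_ _ AT)]]. Qed.

End BoundedOperators.

(** * Finite groups: inner product, adjoints and commutants *)

Section FiniteGroup.
Context {R : realType} {G : finGroupType}.
Local Notation l2 := (ell2 R G).
Implicit Types (xi eta : l2) (S T : l2 -> l2) (A : set (l2 -> l2)).

(** The net of partial sums is constant from the full set [G] onwards. *)
Lemma ell2_innerE xi eta : ell2_inner xi eta = \sum_g xi g * (eta g)^*.
Proof.
rewrite /ell2_inner /summability.sum.
apply: (@lim_near_cst _ (@norm_hausdorff _ R[i]^o)).
  exact: summability.totally_filter.
exists (seq_fset tt (enum G)) => // B sub.
rewrite /summability.partial_sum.
rewrite -(big_seq_fsetE _ _ predT (fun g : G => xi g * (eta g)^*)) /=.
transitivity (\sum_(i <- enum G) (xi i * (eta i)^*)); last by rewrite big_enum.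
apply: perm_big; apply: uniq_perm; rewrite ?enum_uniq ?fset_uniq// => g.
rewrite mem_enum [RHS]inE; apply: (fsubsetP sub).
by rewrite seq_fsetE mem_enum.
Qed.

Lemma ell2_inner_lin2 (a b : R[i]) xi xi' eta :
  ell2_inner (a *: xi + b *: xi') eta =
  a * ell2_inner xi eta + b * ell2_inner xi' eta.
Proof.
rewrite !ell2_innerE !mulr_sumr -big_split; apply: eq_bigr => g _ /=.
by rewrite !mulrA -mulrDl.
Qed.

Lemma ell2_innerC xi eta : ell2_inner xi eta = (ell2_inner eta xi)^*.
Proof.
rewrite !ell2_innerE rmorph_sum; apply: eq_bigr => g _ /=.
by rewrite rmorphM /= conjCK mulrC.
Qed.

Lemma ell2_inner_delta xi (g : G) : ell2_inner xi (ell2_delta g) = xi g.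
Proof.
rewrite ell2_innerE (bigD1 g)//= eqxx rmorph1 mulr1 big1 ?addr0// => h hg.
by rewrite (negbTE hg) rmorph0 mulr0.
Qed.

Lemma ell2_inner_inj xi eta :
  (forall zeta, ell2_inner zeta xi = ell2_inner zeta eta) -> xi = eta.
Proof.
move=> e; apply: ell2P => g; rewrite -!ell2_inner_delta.
by rewrite ell2_innerC e -ell2_innerC.
Qed.

Lemma adjoint_unique T S S' : is_adjoint T S -> is_adjoint T S' -> S = S'.
Proof.
move=> TS TS'; apply/funext => eta; apply: ell2_inner_inj => xi.
by rewrite -TS TS'.
Qed.

(** Uniqueness of the adjoint pins down the operator that [xget] selects. *)
Lemma op_adjE T S : bounded_op S -> is_adjoint T S -> op_adj T = S.
Proof.
move=> bS TS; rewrite /op_adj; case: xgetP => [S' _ [_ TS']|/(_ S) []//].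
exact: adjoint_unique TS' TS.
Qed.

(** Taking adjoints in T U' = U' T, with U' in [A] the adjoint of U, shows that the adjoint of T
    commutes with U. This is the source of all von Neumann algebras below. *)
Lemma commutant_vN A : A `<=` bounded_op ->
  (forall S, A S -> exists2 S', A S' & is_adjoint S S') ->
  vN_algebra (commutant A).
Proof.
move=> bA adjA; split.
- split=> [T []//|]; split; [exact: bounded_id|by []].
- move=> a S T [bS cS] [bT cT]; split; first exact: bounded_lin.
  move=> U AU; apply/funext => xi /=.
  have [linU _] := bA _ AU; rewrite linU.
  rewrite [S (U _)](congr1 (@^~ xi) (cS U AU)).
  by rewrite [T (U _)](congr1 (@^~ xi) (cT U AU)).
- move=> S T [bS cS] [bT cT]; split; first exact: bounded_comp.
  by move=> U AU; rewrite -compA cT// compA cS.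
- move=> T [bT cT]; rewrite /op_adj; case: xgetP => [S _ [bS TS]|_].
    split=> // U AU; have [U' AU' UU'] := adjA _ AU.
    have U'U : is_adjoint U' U.
      by move=> x y; rewrite ell2_innerC -UU' -ell2_innerC.
    apply/funext => eta; apply: ell2_inner_inj => xi /=.
    rewrite -TS -!U'U -TS; congr ell2_inner.
    exact/esym/(congr1 (@^~ xi) (cT _ AU')).
  (* Here [op_adj T] has its default value 0, which also lies in the commutant. *)
  split=> [|U AU]; last first.
    have [linU _] := bA _ AU; apply/funext => xi /=.
    by rewrite linear_at0.
  apply/bounded_opP; split=> [a x y|]; first by rewrite scaler0 addr0.
  exists 0 => // xi; rewrite mul0e /sqnorm esum1// => g _.
  by rewrite [X in Normc.normc X]/(0 : R[i]) Normc.normc0 expr0n.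
(* A''' = A': one inclusion reverses A <= A'', the other is A' <= (A')''. *)
- apply/seteqP; split; first exact/commutant_anti/sub_bicommutant.
  by apply: sub_bicommutant => T [].
Qed.

Lemma ell2_sumE (I : Type) (r : seq I) (P : pred I) (F : I -> l2) (g : G) :
  (\sum_(i <- r | P i) F i) g = \sum_(i <- r | P i) F i g.
Proof. by elim/big_rec2: _ => // i y1 y2 _ <-. Qed.

Lemma linear_comb T (I : Type) (r : seq I) (a : I -> R[i]) (F : I -> l2) :
  linear T -> T (\sum_(i <- r) a i *: F i) = \sum_(i <- r) a i *: T (F i).
Proof.
move=> linT; elim/big_rec2: _ => [|i y1 y2 _ <-]; last exact: linT.
exact: linear_at0.
Qed.

Lemma vN_algebra_comb A (I : Type) (r : seq I) (a : I -> R[i])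
    (F : I -> l2 -> l2) : vN_algebra A -> (forall i, A (F i)) ->
  A (fun xi => \sum_(i <- r) a i *: F i xi).
Proof.
move=> [[_ Aid] Alin _ _ _] AF; elim: r => [|i r IHr].
  (* The zero operator is reached as -id + id, from [A id] and closure under combinations. *)
  rewrite (_ : (fun _ => _) = fun xi => -1 *: id xi + id xi); first exact: Alin.
  by apply/funext => xi; rewrite big_nil scaleN1r addNr.
rewrite (_ : (fun _ => _) =
    fun xi => a i *: F i xi + \sum_(i <- r) a i *: F i xi); first exact: Alin.
by apply/funext => xi; rewrite big_cons.
Qed.

Lemma vN_algebra_lin2 A (a b : R[i]) S T : vN_algebra A -> A S -> A T ->
  A (fun xi => a *: S xi + b *: T xi).
Proof.
move=> vA AS AT; pose F (c : bool) := if c then S else T.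
have AF c : A (F c) by case: c.
have := vN_algebra_comb [:: true; false]
  (fun c : bool => if c then a else b) vA AF.
by congr A; apply/funext => xi; rewrite !big_cons big_nil addr0.
Qed.

(** Writing the vector as a combination of point masses makes square summability of [f]
    automatic. *)
Definition ell2_of (f : G -> R[i]) : l2 := \sum_(g : G) f g *: ell2_delta g.

Lemma ell2_ofE (f : G -> R[i]) (h : G) : ell2_of f h = f h.
Proof.
rewrite /ell2_of ell2_sumE.
transitivity (\sum_(g : G) f g * (h == g)%:R); first exact: eq_bigr.
rewrite (bigD1 h)//= big1 ?addr0 ?eqxx ?mulr1// => g gh.
by rewrite eq_sym (negbTE gh) mulr0.
Qed.

Lemma ell2_expand xi : xi = \sum_(g : G) xi g *: ell2_delta g.
Proof. by apply: ell2P => h; rewrite -[RHS]/(ell2_of xi h) ell2_ofE. Qed.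

Lemma lreg_adjoint (g : G) : is_adjoint (lreg g : l2 -> l2) (lreg g^-1%g).
Proof.
move=> xi eta; rewrite !ell2_innerE (reindex_inj (mulgI g)) /=.
by apply: eq_bigr => h _; rewrite mulKg invgK.
Qed.

Lemma lreg_gvN (H : {pred G}) (h : G) :
  h \in H -> gvN H (lreg h : l2 -> l2).
Proof. by move=> Hh A [_ sA]; apply: sA; exists h. Qed.

(** * States of subalgebras, and the values of the states of L(H) *)

Lemma phi_stateE (M : set (l2 -> l2)) (g : G) :
  phi_state M g = tau0 (cond_exp M (lreg g) \o lreg g^-1%g).
Proof.
congr (tau0 (_ \o _)); apply: op_adjE; first exact: lreg_bounded.
exact: lreg_adjoint.
Qed.

Lemma cond_expP (M : set (l2 -> l2)) :
  is_cond_exp M (cond_exp M) \/ cond_exp M = id.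
Proof. by rewrite /cond_exp; case: xgetP => [E _|]; [left|right]. Qed.

Lemma phi_id (M : set (l2 -> l2)) (g : G) :
  cond_exp M (lreg g) = lreg g -> phi_state M g = 1.
Proof.
move=> Eg; rewrite phi_stateE Eg lregM mulgV lreg1 /tau0.
by rewrite ell2_inner_delta /= eqxx.
Qed.

Lemma vN_algebra_commutant_lreg :
  vN_algebra (commutant (range (lreg : G -> l2 -> l2))).
Proof.
apply: commutant_vN => [_ [g _ <-]|_ [g _ <-]]; first exact: lreg_bounded.
by exists (lreg g^-1%g); [exists g^-1%g|exact: lreg_adjoint].
Qed.

(** The orthogonal projection onto the functions supported on [H]. For a subgroup it commutes with
    [lreg h] for all [h \in H], hence with L(H). *)
Definition ell2_restr (H : {pred G}) xi : l2 :=
  ell2_of (fun g => (g \in H)%:R * xi g).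

Lemma ell2_restr_bounded (H : {pred G}) : bounded_op (ell2_restr H).
Proof.
apply/bounded_opP; split=> [a x y|].
  apply: ell2P => g; rewrite -[RHS]/(a * ell2_restr H x g + ell2_restr H y g).
  rewrite !ell2_ofE.
  by rewrite -[(a *: x + y) g]/(a * x g + y g) mulrDr mulrCA.
exists 1 => // xi; rewrite mul1e; apply: le_esum => g _.
rewrite lee_fin ell2_ofE; case: (g \in H); first by rewrite mul1r.
by rewrite mul0r Normc.normc0 expr0n sqr_ge0.
Qed.

Lemma ell2_restr_self_adjoint (H : {pred G}) :
  is_adjoint (ell2_restr H) (ell2_restr H).
Proof.
move=> xi eta; rewrite !ell2_innerE; apply: eq_bigr => g _.
by rewrite !ell2_ofE rmorphM /= rmorph_nat mulrAC mulrC mulrA [X in X * _]mulrC.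
Qed.

(* If [cond_exp] were to take its default value [id], [phi_state] would be
   constantly 1, so the existence of the expectation onto L(H) is not needed. *)
Lemma phi_state_group (H : {pred G}) (g : G) : group_closed H ->
  phi_state (gvN H : set (l2 -> l2)) g \in [:: 0; 1].
Proof.
move=> gH; pose M : set (l2 -> l2) := gvN H; rewrite -/M !inE.
have [[[EM Eid] _ _ _ _]|Eid] := cond_expP M; last first.
  by rewrite phi_id ?Eid// eqxx orbT.
case: (boolP (g \in H)) => Hg.
  by rewrite (phi_id (Eid _ (lreg_gvN Hg))) eqxx orbT.
(* The commutant of the projection is a von Neumann algebra containing the generators of L(H), so it
   contains L(H) and in particular the expectation of [lreg g]. *)
have [[linE _] cE] : commutant [set ell2_restr H] (cond_exp M (lreg g)).
  apply: (EM (lreg g)); first exact: lreg_gvN.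
  split=> [|_ [h Hh <-]].
    apply: commutant_vN => [_ ->|_ ->]; first exact: ell2_restr_bounded.
    by exists (ell2_restr H) => //; exact: ell2_restr_self_adjoint.
  split=> [|_ ->]; first exact: lreg_bounded.
  apply/funext => xi; apply: ell2P => k /=; rewrite !ell2_ofE.
  have -> // : ((h^-1 * k)%g \in H) = (k \in H).
  apply/idP/idP => Hk; last by rewrite (group_closedM gH) ?(group_closedV gH).
  by rewrite -(mulKVg h k) (group_closedM gH).
(* The coordinate at 1 of the image of the point mass at [g^-1] is exactly the state at [g]. The
   projection kills this point mass, as [g^-1] is outside [H], but keeps the coordinate at 1, so the
   state vanishes. *)
have /(_ _ erefl)/(congr1 (fun T => T (ell2_delta g^-1%g) 1%g)) /= := cE.
rewrite (_ : ell2_restr H (ell2_delta _) = 0); last first.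
  apply: ell2P => k; rewrite ell2_ofE [RHS]/(0 : R[i]) /=.
  case: eqVneq => [->|]; last by rewrite mulr0.
  rewrite (_ : (_ \in H) = false) ?mul0r//; apply/negbTE.
  apply: contra Hg => Hg.
  by rewrite -(invgK g) (group_closedV gH).
rewrite linear_at0// ell2_ofE gH.1 mul1r [LHS]/(0 : R[i]) => E0.
by rewrite phi_stateE /tau0 ell2_inner_delta /= lreg_delta mulg1 -E0 eqxx.
Qed.

(** Grouping indices by the fibres of [f] turns the form into the sum over [k] of |s k|^2, where
    [s k] adds up [c] over the fibre of [k]. *)
Lemma sum_same_fibre_ge0 (K : finType) (n : nat) (f : 'I_n -> K)
    (c : 'I_n -> R[i]) :
  0 <= \sum_(i < n) \sum_(j < n) c i * (c j)^* * (f j == f i)%:R.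
Proof.
pose s k := \sum_(i < n) c i * (f i == k)%:R.
suff -> : \sum_(i < n) \sum_(j < n) c i * (c j)^* * (f j == f i)%:R =
    \sum_k s k * (s k)^*.
  by apply: sumr_ge0 => k _; exact: mul_conjC_ge0.
under [RHS]eq_bigr do rewrite mulr_suml.
rewrite [RHS]exchange_big; apply: eq_bigr => i _ /=.
rewrite [RHS](bigD1 (f i))//= [X in _ + X]big1 => [|k ki]; last first.
  by rewrite eq_sym (negbTE ki) mulr0 mul0r.
rewrite eqxx mulr1 addr0 rmorph_sum mulr_sumr; apply: eq_bigr => j _ /=.
by rewrite rmorphM /= rmorph_nat mulrA.
Qed.

(** * Abelian groups: L(G) as the commutant of the translations *)

Context (mulGC : commutative (@mulg G)).

Lemma lreg_comm (g h : G) : (lreg g : l2 -> l2) \o lreg h = lreg h \o lreg g.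
Proof. by rewrite !lregM mulGC. Qed.

(** The translates of the point mass at 1 span the whole space, so an operator commuting with
    translations is determined by its value there. *)
Lemma commutant_lreg_eq S T : commutant (range lreg) S ->
  commutant (range lreg) T ->
  S (ell2_delta 1%g) = T (ell2_delta 1%g) -> S = T.
Proof.
move=> [[linS _] cS] [[linT _] cT] ST; apply/funext => xi.
rewrite (ell2_expand xi) !linear_comb//; apply: eq_bigr => g _; congr (_ *: _).
rewrite -(mulg1 g) -lreg_delta.
have lg : range lreg (lreg g : l2 -> l2) by exists g.
rewrite [LHS](congr1 (@^~ _) (cS _ lg)) [RHS](congr1 (@^~ _) (cT _ lg)) /=.
by rewrite ST.
Qed.

(** Translations commute with each other, which gives one inclusion. Conversely, an operator T in
    the commutant agrees at the point mass at 1 with the combination of the [lreg g] whose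
    coefficients are the coordinates of T applied to that mass. *)
Lemma gvNTE : (gvNT : set (l2 -> l2)) = commutant (range lreg).
Proof.
have lregC g : commutant (range lreg) (lreg g : l2 -> l2).
  by split=> [|_ [h _ <-]]; [exact: lreg_bounded|exact: lreg_comm].
apply/seteqP; split=> [T|T CT A [vA sA]].
  apply; split; first exact: vN_algebra_commutant_lreg.
  by move=> _ [g _ <-].
pose a g := T (ell2_delta 1%g) g.
have Alreg g : A (lreg g : l2 -> l2) by apply: sA; exists g.
suff -> : T = (fun xi => \sum_(g : G) a g *: lreg g xi).
  exact: vN_algebra_comb.
apply: commutant_lreg_eq => //.
  exact: (vN_algebra_comb _ _ vN_algebra_commutant_lreg lregC).
rewrite [LHS]ell2_expand; apply: eq_bigr => g _.
by rewrite lreg_delta mulg1.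
Qed.

(** * The flip W and its fixed-point algebra *)

Definition ell2_flip xi : l2 := ell2_of (fun g => xi g^-1%g).

Lemma ell2_flipK : involutive ell2_flip.
Proof. by move=> xi; apply: ell2P => g; rewrite !ell2_ofE invgK. Qed.

Lemma ell2_flip_linear : linear ell2_flip.
Proof.
move=> a x y; apply: ell2P => g.
by rewrite -[RHS]/(a * ell2_flip x g + ell2_flip y g) !ell2_ofE.
Qed.

Lemma ell2_flip_bounded : bounded_op ell2_flip.
Proof.
apply: isometry_bounded => [|xi]; first exact: ell2_flip_linear.
apply/esym; rewrite /sqnorm (reindex_esum setT setT (fun g : G => g^-1%g)).
- by apply: eq_esum => g _; rewrite ell2_ofE.
- split=> // [x y _ _ /invg_inj//|x _].
  by exists x^-1%g => //; rewrite invgK.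
Qed.

Lemma ell2_flip_self_adjoint : is_adjoint ell2_flip ell2_flip.
Proof.
move=> xi eta; rewrite !ell2_innerE (reindex_inj invg_inj) /=.
by apply: eq_bigr => g _; rewrite !ell2_ofE invgK.
Qed.

(** Inversion is an automorphism of an abelian group; hence conjugation by the flip preserves
    L(G). *)
Lemma ell2_flip_lreg (g : G) : ell2_flip \o lreg g = lreg g^-1%g \o ell2_flip.
Proof.
apply/funext => xi; apply: ell2P => k; rewrite /= !ell2_ofE /=.
by rewrite invgK invgM mulGC.
Qed.

Lemma ell2_flip_delta (g : G) : ell2_flip (ell2_delta g) = ell2_delta g^-1%g.
Proof.
apply: ell2P => k; rewrite ell2_ofE /=; congr (_ %:R); congr nat_of_bool.
by rewrite (can2_eq invgK invgK).
Qed.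

(** By [gvNTE] this is the part of L(G) commuting with the flip. Writing it as a single commutant
    makes [commutant_vN] applicable. *)
Definition symvN : set (l2 -> l2) := commutant ([set ell2_flip] `|` range lreg).

Lemma symvN_subalgebra : vN_subalgebra symvN.
Proof.
split; last by rewrite gvNTE; apply: commutant_anti => T; right.
apply: commutant_vN => [_ [->|[g _ <-]]|_ [->|[g _ <-]]].
- exact: ell2_flip_bounded.
- exact: lreg_bounded.
- by exists ell2_flip; [left|exact: ell2_flip_self_adjoint].
- by exists (lreg g^-1%g); [right; exists g^-1%g|exact: lreg_adjoint].
Qed.

Definition sym_exp T : l2 -> l2 :=
  fun xi => 2^-1 *: T xi + 2^-1 *: ell2_flip (T (ell2_flip xi)).

Lemma symvN_flip T xi : symvN T -> T (ell2_flip xi) = ell2_flip (T xi).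
Proof.
by case=> _ /(_ ell2_flip (or_introl erefl))/(congr1 (fun S => S xi)).
Qed.

Lemma half_twice (V : lmodType R[i]) (x : V) : 2^-1 *: x + 2^-1 *: x = x.
Proof.
rewrite -scalerDl -[RHS]scale1r; congr (_ *: _).
by rewrite [RHS]splitr !mul1r.
Qed.

(** Elements of [symvN] pass through the flip, which gives the bimodule property. The flip is
    self-adjoint, so conjugation by it preserves positivity; it fixes the point mass at 1, so
    conjugation also preserves the trace. *)
Lemma sym_exp_cond_exp : is_cond_exp symvN sym_exp.
Proof.
split.
- split=> [x|m Mm]; last first.
    apply/funext => xi.
    by rewrite /sym_exp (symvN_flip _ Mm) ell2_flipK half_twice.
  rewrite gvNTE => Cx; have [bx cx] := Cx.
  have CE : commutant (range lreg) (sym_exp x).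
    apply: (vN_algebra_lin2 (T := ell2_flip \o x \o ell2_flip) _ _
      vN_algebra_commutant_lreg) => //.
    split=> [|_ [g _ <-]].
      apply: (bounded_comp _ ell2_flip_bounded).
      exact: (bounded_comp ell2_flip_bounded bx).
    rewrite -compA ell2_flip_lreg compA -(compA ell2_flip).
    rewrite cx; last by exists g^-1%g.
    by rewrite compA ell2_flip_lreg invgK.
  split; first by have [] := CE.
  move=> S [->|]; last by have [_] := CE; apply.
  apply/funext => xi; rewrite /sym_exp /=.
  by rewrite (linear_lin2 _ _ _ _ ell2_flip_linear) !ell2_flipK addrC.
- move=> a x y _ _; apply/funext => xi; rewrite /sym_exp ell2_flip_linear.
  by rewrite !scalerDr !scalerA addrACA mulrC.
- move=> m n x Mm Mn _; have [[linm _] _] := Mm; apply/funext => xi.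
  rewrite /sym_exp /= (linear_lin2 _ _ _ _ linm); congr (_ + _ *: _).
  by rewrite (symvN_flip _ Mn) (symvN_flip _ Mm).
- move=> x _ x0 xi; rewrite /sym_exp ell2_inner_lin2 ell2_flip_self_adjoint.
  by rewrite addr_ge0// mulr_ge0// ?invr_ge0//; exact: x0.
- move=> x _; rewrite /tau0 /sym_exp ell2_inner_lin2 ell2_flip_self_adjoint.
  rewrite ell2_flip_delta invg1.
  set t := ell2_inner _ _; exact: (@half_twice R[i]^o t).
Qed.

(* With [n = lambda_g + lambda_{g^-1}] in M and [y = E_M(lambda_g)], invariance
   of [y] under the flip gives [2 phi_M(g) = tau0(y n) = tau0(lambda_g n)]. *)
Lemma phi_symvN (g : G) :
  phi_state symvN g = 2^-1 * (1 + (g * g == 1)%g%:R) :> R[i].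
Proof.
(* Since [sym_exp] witnesses existence, [xget] returns a genuine expectation; the computation then
   rests on its axioms alone. *)
have Ex : is_cond_exp symvN (cond_exp symvN).
  by rewrite /cond_exp; case: xgetP => // /(_ _ sym_exp_cond_exp).
have [[EM _] _ Emod _ Etr] := Ex.
pose y : l2 -> l2 := cond_exp symvN (lreg g).
have [vM sMT] := symvN_subalgebra.
have lregT h : gvNT (lreg h : l2 -> l2) by exact: lreg_gvN.
have My : symvN y by exact: EM.
have [[liny _] _] := My.
have [[_ Mid] _ _ _ _] := vM.
pose n : l2 -> l2 := fun xi => 1 *: lreg g xi + 1 *: lreg g^-1%g xi.
have vT : vN_algebra (gvNT : set (l2 -> l2)).
  by rewrite gvNTE; exact: vN_algebra_commutant_lreg.
have Tn : gvNT n by exact: (vN_algebra_lin2 _ _ vT (lregT g) (lregT g^-1%g)).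
have Mn : symvN n.
  have := Tn; rewrite gvNTE => -[bn cn]; split=> // S [->|]; last exact: cn.
  apply/funext => xi; rewrite /n /= (linear_lin2 _ _ _ _ ell2_flip_linear).
  rewrite [ell2_flip (lreg g xi)](congr1 (@^~ xi) (ell2_flip_lreg g)).
  rewrite [ell2_flip (lreg _ xi)](congr1 (@^~ xi) (ell2_flip_lreg g^-1%g)) /=.
  by rewrite invgK addrC.
have [_ _ TM _ _] := vT.
have := Etr _ (TM _ _ (lregT g) Tn).
(* The bimodule property is two-sided, so [id] is inserted as the left factor. *)
rewrite -[_ \o n]/(id \o lreg g \o n) Emod// -/y /tau0 !ell2_inner_delta.
rewrite -[(_ \o n) _]/(y (n _)) -[(id \o _ \o n) _]/(lreg g (n _)).
rewrite {1 2}/n !lreg_delta !mulg1 (linear_lin2 _ _ _ _ liny).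
rewrite (linear_lin2 _ _ _ _ (lreg_bounded g).1) !lreg_delta mulgV !scale1r.
have ysym : y (ell2_delta g) 1%g = y (ell2_delta g^-1%g) 1%g.
  by rewrite -[in RHS]ell2_flip_delta (symvN_flip _ My) ell2_ofE invg1.
rewrite phi_stateE /tau0 ell2_inner_delta -[(_ \o lreg _) _]/(y _) lreg_delta.
rewrite !mulg1 -[LHS]/(y _ 1%g + y _ 1%g) ysym.
rewrite -[RHS]/(ell2_delta _ 1%g + ell2_delta _ 1%g).
rewrite /= eqxx addrC eq_sym => ysum.
rewrite (addrC 1) -[_ + 1]/(_ + true%:R) -ysum.
by rewrite mulrDr; exact/esym/(@half_twice R[i]^o _).
Qed.

(** By commutativity, (g_j^-1 g_i)^2 = 1 exactly when g_j^2 = g_i^2. The form is therefore half the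
    sum of two same-fibre forms, one for a constant map and one for the squaring map. *)
Lemma symvN_PD1 : PD1 (phi_state symvN : G -> R[i]).
Proof.
split; last first.
  rewrite phi_symvN mulg1 eqxx mulrDr; exact: (@half_twice R[i]^o 1).
move=> n g c.
have sq (i j : 'I_n) :
    ((g j)^-1 * g i * ((g j)^-1 * g i) == 1)%g = (g j * g j == g i * g i)%g.
  have -> : ((g j)^-1 * g i * ((g j)^-1 * g i) =
             (g j * g j)^-1 * (g i * g i))%g.
    rewrite invgM -!mulgA; congr mulg.
    by rewrite mulGC -!mulgA; congr mulg; rewrite mulGC.
  by rewrite -eq_invg_mul invgK.
under eq_bigr do under eq_bigr do
  rewrite phi_symvN sq mulrCA mulrDr mulr1.
under eq_bigr do rewrite -mulr_sumr big_split.
rewrite -mulr_sumr big_split mulr_ge0 ?invr_ge0 ?addr_ge0//=.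
  apply: le_trans (sum_same_fibre_ge0 (fun=> tt) c) _.
  by rewrite le_eqVlt; apply/predU1P; left; do 2 (apply: eq_bigr => ? _);
    rewrite eqxx mulr1.
exact: (sum_same_fibre_ge0 (fun i => g i * g i)%g c).
Qed.

End FiniteGroup.

(** * The cyclic group of order three *)

Lemma half_neq01 (R : realType) : (2^-1 : R[i]) \notin [:: 0; 1].
Proof. by rewrite !inE invr_eq0 invr_eq1 pnatr_eq0 pnatr_eq1. Qed.

Theorem theorem4p15 (R : realType) :
  exists Gamma : groupType, countable [set: Gamma] /\
  exists HH : set {ptws Gamma -> R[i]^o},
    [/\ uniformly_recurrent_state HH,
        (forall f, HH f ->
           ~ exists H : {pred Gamma}, group_closed H /\ f = phi_state (gvN H)) &
        (forall X : set {ptws Gamma -> bool},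
           uniformly_recurrent_subgroup X ->
           HH <> [set phi_state (gvN (H : {pred Gamma})) | H in X])].
Proof.
pose G : finGroupType := 'I_3.
have mulGC : commutative (@mulg G) by exact: Zp_mulgC.
exists G; split; first exact: (@countableP G).
pose phi : {ptws G -> R[i]^o} := phi_state (symvN : set (ell2 R G -> ell2 R G)).
have phi_nH (H : {pred G}) : group_closed H -> phi <> phi_state (gvN H).
  move=> gH phiH.
  (* The group law on ['I_3] is addition mod 3, so the square of the generator is 2, not the
     identity 0, and [phi] takes the value 1/2 at it. *)
  have : (phi : G -> R[i]) (inord 1) \in [:: 0; 1].
    by rewrite phiH; exact: phi_state_group.
  rewrite /phi phi_symvN//.
  rewrite [_ == _](_ : _ = false) ?addr0 ?mulr1 ?(negbTE (half_neq01 R))//.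
  by apply/negbTE/eqP => /(congr1 val); rewrite /= inordK.
have phi_in : subalgebra_states phi.
  split; first exact: symvN_PD1.
  by apply: subset_closure; exists symvN => //; exact: symvN_subalgebra.
exists [set phi]; split.
- split=> [|Z [[z Zz] _ _ _] sZ]; last first.
    by apply/seteqP; split=> // _ ->; rewrite -(sZ _ Zz).
  split.
  + by exists phi.
  + by move=> _ ->.
  + apply: closed_subspaceW; apply: accessible_closed_set1.
    apply: hausdorff_accessible.
    by apply: hausdorff_product => _; exact: norm_hausdorff.
  + move=> s _ ->; apply/funext => g; rewrite /state_act.
    by rewrite (mulGC s^-1%g) mulgKV.
- by move=> _ -> [H [gH]]; exact: phi_nH.
(* A Uniformly Recurrent Subgroup is non-empty, so equality would place the state of some L(H) in
   the singleton. *)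
- move=> X [[[H XH] sX _ _] _] HX.
  have : [set phi] (phi_state (gvN (H : {pred G}))) by rewrite HX; exists H.
  by move/esym; apply: phi_nH; exact: sX.
Qed.
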